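(* Let $G=(V,E)$ be a signed graph with $E=E_+\sqcup E_-$. Then $G$ is signed-eliminable if and only if all of the following three conditions hold: (C1) Both $G_+$ and $G_-$ are chordal. (C2) For every $\sigma\in\{+,-\}$ and every four distinct vertices $u,v,w,x$ of $G$ with $uv\in E_\sigma$, $vw\in E_{-\sigma}$, $wx\in E_\sigma$, we have either ($uw\in E_\sigma$ and $ux\in E_\sigma$) or ($ux\in E_\sigma$ and $vx\in E_\sigma$). (C3) $G$ contains no mountain and no hill as an induced subgraph.
   Context: All graphs are finite, simple and undirected. A signed graph is a graph $G=(V,E)$ together with a partition $E=E_+\sqcup E_-$ (either part may be empty); put $G_\sigma=(V,E_\sigma)$ for $\sigma\in\{+,-\}$, and let $-\sigma$ be the opposite sign. Induced subgraphs of a signed graph inherit the signs. A graph is chordal if it has no induced cycle of length at least four. An ordering on $G$ is a bijection $\nu:V\to\{1,\dots,|V|\}$. It is a signed elimination ordering (SEO) if for every triple $(u,v,w)$ of distinct vertices with $\nu(u)<\nu(w)>\nu(v)$ and each $\sigma\in\{+,-\}$: (E1) if $uw,wv\in E_\sigma$ then $uv\in E_\sigma$; (E2) if $uv\in E_\sigma$ and $vw\in E_{-\sigma}$ then $uw\in E_\sigma$. $G$ is signed-eliminable if it admits a SEO. A mountain is a signed graph for which there are $\sigma\in\{+,-\}$ and an enumeration $(v_1,\dots,v_n;w)$ of its (distinct) vertices, $n\ge 3$, such that $v_iv_{i+1}\in E_{-\sigma}$ for $1\le i\le n-1$, $wv_i\in E_\sigma$ for $2\le i\le n-1$, and no other pair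 of vertices is joined by an edge. A hill is a signed graph for which there are $\sigma\in\{+,-\}$ and an enumeration $(v_1,\dots,v_n;w_1,w_2)$ of its (distinct) vertices, $n\ge 2$, such that $v_iv_{i+1}\in E_{-\sigma}$ for $1\le i\le n-1$, $w_1w_2\in E_\sigma$, $w_1v_i\in E_\sigma$ for $1\le i\le n-1$, $w_2v_i\in E_\sigma$ for $2\le i\le n$, and no other pair of vertices is joined by an edge. *)

(* Defs.v *)
From mathcomp Require Import all_boot.

Set Implicit Arguments.
Unset Strict Implicit.
Unset Printing Implicit Defensive.

(* Signs are booleans: [true] stands for +, [false] for -, and [~~ s] for the
   opposite sign. [edge s] is the adjacency relation of the graph G_s, and the
   underlying graph has adjacency relation [adj]. *)
Record signed_graph := SignedGraph {
  vertex :> finType;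
  edge : bool -> rel vertex;
  edge_sym : forall s, symmetric (edge s);
  edge_irr : forall s, irreflexive (edge s);
  edge_disj : forall s x y, edge s x y -> ~~ edge (~~ s) x y
}.

Definition adj (G : signed_graph) (x y : G) : bool :=
  [exists s, edge s x y].

Section Induced.
Variables (G : signed_graph) (A : {set G}).

Definition induced_edge (s : bool) : rel {x : G | x \in A} :=
  fun x y => edge s (val x) (val y).

Fact induced_edge_sym s : symmetric (induced_edge s).
Proof. by move=> x y; apply: edge_sym. Qed.

Fact induced_edge_irr s : irreflexive (induced_edge s).
Proof. by move=> x; apply: edge_irr. Qed.

Fact induced_edge_disj s x y :
  induced_edge s x y -> ~~ induced_edge (~~ s) x y.
Proof. exact: edge_disj. Qed.

Definition induced : signed_graph :=
  SignedGraph induced_edge_sym induced_edge_irr induced_edge_disj.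

End Induced.

(* [ordS] is the cyclic successor on ['I_n]. *)
Definition induced_cycle (V : finType) (e : rel V) (n : nat) (c : 'I_n -> V) :
    Prop :=
  injective c /\
  forall i j : 'I_n, e (c i) (c j) = (j == ordS i) || (i == ordS j).

Definition chordal (V : finType) (e : rel V) : Prop :=
  forall (n : nat) (c : 'I_n -> V), 4 <= n -> ~ induced_cycle e c.

(* Orderings take values in {0, ..., |V| - 1} instead of {1, ..., |V|}. *)
Definition is_SEO (G : signed_graph) (nu : G -> 'I_#|G|) : Prop :=
  bijective nu /\
  forall u v w : G, uniq [:: u; v; w] -> nu u < nu w -> nu v < nu w ->
  forall s : bool,
    (edge s u w -> edge s w v -> edge s u v) /\
    (edge s u v -> edge (~~ s) v w -> edge s u w).

Definition signed_eliminable (G : signed_graph) : Prop :=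
  exists nu : G -> 'I_#|G|, is_SEO nu.

(* In mountains and hills the path v_1, ..., v_n is indexed from 0, so v_1 is
   the vertex of index 0 and v_n the vertex of index n - 1. *)
Definition is_mountain (G : signed_graph) : Prop :=
  exists (s : bool) (n : nat) (v : 'I_n -> G) (w : G),
    [/\ 3 <= n,
        [/\ injective v, forall i, v i != w
          & forall x : G, x = w \/ exists i, x = v i],
        forall i j : 'I_n, j = i.+1 :> nat -> edge (~~ s) (v i) (v j),
        forall i : 'I_n, 0 < i < n.-1 -> edge s w (v i)
      & forall x y : G, adj x y ->
          (exists i j : 'I_n,
             j = i.+1 :> nat /\ [set x; y] = [set v i; v j]) \/
          (exists i : 'I_n, 0 < i < n.-1 /\ [set x; y] = [set w; v i])].

Definition is_hill (G : signed_graph) : Prop :=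
  exists (s : bool) (n : nat) (v : 'I_n -> G) (w1 w2 : G),
    [/\ 2 <= n,
        [/\ injective v, w1 != w2, forall i, v i != w1 /\ v i != w2
          & forall x : G, [\/ x = w1, x = w2 | exists i, x = v i]],
        forall i j : 'I_n, j = i.+1 :> nat -> edge (~~ s) (v i) (v j),
        [/\ edge s w1 w2,
            forall i : 'I_n, i < n.-1 -> edge s w1 (v i)
          & forall i : 'I_n, 0 < i -> edge s w2 (v i)]
      & forall x y : G, adj x y ->
          [\/ exists i j : 'I_n,
                j = i.+1 :> nat /\ [set x; y] = [set v i; v j],
              [set x; y] = [set w1; w2],
              exists i : 'I_n, i < n.-1 /\ [set x; y] = [set w1; v i]
            | exists i : 'I_n, 0 < i /\ [set x; y] = [set w2; v i]]].

Definition condC1 (G : signed_graph) : Prop :=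
  chordal (@edge G true) /\ chordal (@edge G false).

Definition condC2 (G : signed_graph) : Prop :=
  forall (s : bool) (u v w x : G), uniq [:: u; v; w; x] ->
    edge s u v -> edge (~~ s) v w -> edge s w x ->
    (edge s u w /\ edge s u x) \/ (edge s u x /\ edge s v x).

Definition condC3 (G : signed_graph) : Prop :=
  forall A : {set G}, ~ is_mountain (induced A) /\ ~ is_hill (induced A).

(* Main.v *)
Require Import Defs.
From mathcomp Require Import all_boot zify.

Set Implicit Arguments.
Unset Strict Implicit.
Unset Printing Implicit Defensive.

(* Write N_s(v) for the s-neighbours of v. A vertex w may come last iff both
   N_s(w) are cliques of G_s and N_{-s}(v) is contained in N_{-s}(w) for every
   s-neighbour v of w, so G is signed-eliminable iff every nonempty vertex set
   has such a removable vertex; a removable vertex of a vertex set spanning an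
   induced cycle, a violation of (C2), a mountain or a hill does not exist.

   Conversely, (C2) says that along an s-edge vw the sets N_{-s}(v), N_{-s}(w)
   are nested and completely joined by (-s)-edges. Call an s-edge an arc towards
   its strictly larger set, and a tie if the sets are equal. Arcs of both signs
   compose well enough to find a tie class M with no arc leaving it. Since there
   is no mountain and no hill, a chordless path cannot rise strictly, stay
   constant and then fall strictly; hence the G_s-boundary of M is a clique, and
   Dirac's argument in the chordal graph G_s yields a simplicial vertex in M,
   which is removable. *)

(** * Simplicial vertices of chordal graphs *)

(** A forward chord of a repetition-free path gives a shortcut, so induction on the length ends at a
    chordless path. *)
Lemma connect_induced_path (V : finType) (r : rel V) (x y : V) :
  connect r x y ->
  exists p, [/\ path r x p, last x p = y, uniq (x :: p)
    & forall i j, i < j < size (x :: p) ->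
        r (nth x (x :: p) i) (nth x (x :: p) j) -> j = i.+1].
Proof.
move=> /connectP[p]; have [n] := ubnP (size p).
elim: n p => // n IHn p; rewrite ltnS => le_p_n rp Ey.
case/shortenP: rp Ey => q rq uq sub_qp Ey.
have le_qp : size q <= size p.
  by apply: uniq_leq_size => [|z /sub_qp //]; case/andP: uq.
have [|ok] := boolP [exists i : 'I_(size q).+1, exists j : 'I_(size q).+1,
  (i.+1 < j) && r (nth x (x :: q) i) (nth x (x :: q) j)]; last first.
  exists q; split=> // i j /andP[ltij ltj] rij; apply/eqP.
  rewrite eqn_leq ltij andbT leqNgt; apply/negP=> lt_ij.
  have lti := ltn_trans ltij ltj.
  move/negP: ok; apply; apply/existsP; exists (Ordinal lti); apply/existsP.
  by exists (Ordinal ltj); rewrite lt_ij.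
case/existsP=> -[i lti] /existsP[[[|j] /= ltj]] //= /andP[]; rewrite ltnS => ltij rij.
have lt_jq : j < size q by [].
have Eq := cat_take_drop j q; rewrite (drop_nth x lt_jq) in Eq.
(* Here [j] is one less than the position of the far end of the chord in [x :: q], so [drop j q]
   starts at that end. *)
apply: (IHn (take i q ++ drop j q)).
- rewrite size_cat size_drop size_takel; last by lia.
  apply: leq_trans (leq_trans le_qp le_p_n).
  by rewrite -ltn_subRL ltn_sub2l // (ltn_trans ltij).
- rewrite cat_path take_path // (drop_nth x lt_jq) /=; apply/andP; split.
    suff -> : last x (take i q) = nth x (x :: q) i by [].
    rewrite -nth_last size_takel; last by lia.
    case: i ltij {lti rij} => [|k] ltkj /=; first by rewrite take0.
    rewrite nth_take //; apply: set_nth_default; lia.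
  by move: rq; rewrite -{1}Eq cat_path /= => /and3P[].
- by rewrite Ey last_cat (drop_nth x lt_jq) -{1}Eq last_cat.
Qed.

Section Dirac.
Variables (V : finType) (e : rel V).
Hypotheses (e_sym : symmetric e) (e_irr : irreflexive e) (e_ch : chordal e).

Definition clique (A : {set V}) : Prop :=
  {in A &, forall x y, x != y -> e x y}.

Definition boundary (A : {set V}) : {set V} :=
  [set x | (x \notin A) && [exists y in A, e x y]].

Definition within (A : {set V}) : rel V :=
  fun x y => [&& x \in A, y \in A & e x y].

Lemma within_sym A : symmetric (within A).
Proof. by move=> x y; rewrite /within e_sym andbCA. Qed.

(** Both [p] and [q] have neighbours in [C], so they are connected inside [B]; a chordless path
    there repeats neither end, so its interior stays in [C]. *)
Lemma induced_path_through (C : {set V}) p q :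
  {in C &, forall x y, connect (within C) x y} ->
  p \in boundary C -> q \in boundary C -> p != q -> ~~ e p q ->
  exists n, exists v : nat -> V,
    [/\ 2 < n, v 0 = p, v n.-1 = q, {in gtn n &, injective v}
      & (forall i, 0 < i < n.-1 -> v i \in C) /\
        (forall i j, i < n -> j < n ->
           e (v i) (v j) = (j == i.+1) || (i == j.+1))].
Proof.
move=> connC; rewrite !inE => /andP[pC /existsP[p' /andP[p'C epp']]].
case/andP=> qC /existsP[q' /andP[q'C eqq']] pDq npq.
pose B := p |: (q |: C).
have subCB : subrel (within C) (within B).
  by move=> x y /and3P[xC yC exy]; rewrite /within !inE xC yC exy !orbT.
have : connect (within B) p q.
  apply: (@connect_trans _ _ p').
    by apply: connect1; rewrite /within !inE eqxx p'C epp' !orbT.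
  apply: (@connect_trans _ _ q').
    apply: connect_sub (connC _ _ p'C q'C) => x y /subCB; exact: connect1.
  by apply: connect1; rewrite /within !inE eqxx q'C e_sym eqq' !orbT.
case/connect_induced_path=> s [rs ls us ind_s].
exists (size (p :: s)), (nth p (p :: s)).
have inB i : i < size (p :: s) -> nth p (p :: s) i \in B.
  case: i => [|i] /= lti; first by rewrite !inE eqxx.
  by have /and3P[] := (pathP p rs) i lti.
have vl : nth p (p :: s) (size s) = q by rewrite -ls (last_nth p).
have s_gt1 : 1 < size s.
  case: s rs ls {us ind_s inB vl} => [|a [|b s]] //=; first by move=> _ /eqP; rewrite (negPf pDq).
  by rewrite andbT => /and3P[_ _ epa] eaq; rewrite -eaq epa in npq.
have injv : {in gtn (size (p :: s)) &, injective (nth p (p :: s))}.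
  by move=> i j; rewrite !inE => lti ltj /eqP; rewrite nth_uniq // => /eqP.
have fwd i j : i < j -> j < size (p :: s) ->
    e (nth p (p :: s) i) (nth p (p :: s) j) = (j == i.+1).
  move=> ltij ltj; have lti := ltn_trans ltij ltj.
  apply/idP/eqP=> [eij|->].
    by apply: ind_s; rewrite ?ltij // /within !inB.
  by have /and3P[] := (pathP p rs) i ltac:(rewrite /= in ltj; lia).
split=> //; split=> [i /andP[i_gt0 lti]|i j lti ltj].
  have := inB i ltac:(rewrite /= in lti *; lia); rewrite !inE.
  have /negPf-> : nth p (p :: s) i != p.
    have := nth_uniq p (i := i) (j := 0) (s := p :: s) _ _ us.
    by move=> -> //; rewrite /= in lti *; lia.
  suff /negPf-> : nth p (p :: s) i != q by [].
  rewrite -vl nth_uniq //=; rewrite /= in lti *; lia.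
have [ltij|ltji|->] := ltngtP i j.
- rewrite fwd //; lia.
- rewrite e_sym fwd //; lia.
- rewrite e_irr; lia.
Qed.

Lemma ordS_eqE n (i j : 'I_n) :
  (j == ordS i) = (j == i.+1 :> nat) || ((i.+1 == n) && (j == 0 :> nat)).
Proof.
rewrite -val_eqE /=; case: (i.+1 =P n) => [->|/eqP ne].
  by rewrite modnn (ltn_eqF (ltn_ord j)).
by rewrite modn_small ?orbF // ltn_neqAle ne ltn_ord.
Qed.

(** A chordless path through [C] between two non-adjacent boundary vertices would close up at [a] to
    an induced cycle, since [a] sees only its ends. *)
Lemma neighbour_boundary_clique (a : V) (C : {set V}) :
  {in C &, forall x y, connect (within C) x y} ->
  (forall x, x \in boundary C -> e a x) -> {in C, forall x, ~~ e a x} ->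
  a \notin C -> clique (boundary C).
Proof.
move=> connC aB aC a_C p q pB qB pDq; apply/negPn/negP=> npq.
have [n [v [n_gt2 v0 vl injv [vC ev]]]] :=
  induced_path_through connC pB qB pDq npq.
have eav i : i < n -> e a (v i) = (i == 0) || (i == n.-1).
  move=> lti; case: (posnP i) => [->|i_gt0]; first by rewrite v0 aB.
  have [->|ne] := eqVneq i n.-1; first by rewrite vl aB // orbT.
  rewrite (negPf (aC _ _)) ?vC //; lia.
have vDa i : i < n -> a != v i.
  move=> lti; apply/eqP=> Ea.
  have := eav i lti; rewrite -Ea e_irr => Ei.
  by move: a_C; rewrite Ea vC //; lia.
apply: (e_ch (n := n.+1) (c := fun i => if val i is k.+1 then v k else a)) => //.
split=> [i j|i j].
  case: i j => [[|i] lti] [[|j] ltj] /=.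
  - by move=> _; apply: val_inj.
  - by move/eqP; rewrite (negPf (vDa j ltj)).
  - by move/esym/eqP; rewrite (negPf (vDa i lti)).
  - by move=> /injv -/(_ lti ltj) Eij; apply: val_inj; rewrite /= Eij.
rewrite !ordS_eqE.
case: i j => [[|i] lti] [[|j] ltj] /=.
- rewrite e_irr; lia.
- rewrite eav //; lia.
- rewrite e_sym eav //; lia.
- rewrite ev //; lia.
Qed.

(** If [a] and [c] are not adjacent, the component of [c] among the non-neighbours of [a] is a
    smaller set whose boundary is again a clique. If no such pair is left, [M] and its boundary form
    a clique and any vertex of [M] serves. *)
Lemma simplicial_exists (M : {set V}) :
  M != set0 -> clique (boundary M) ->
  exists2 m, m \in M & clique [set x | e m x].
Proof.
have [n] := ubnP #|M|; elim: n M => // n IHn M; rewrite ltnS => leMn.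
move=> /set0Pn[c0 c0M] clM.
(* The last premise keeps the component of [c] inside [M]: to leave [M] it would have to meet a
   boundary vertex, which is [a] or joined to [a]. *)
have step a c : a \in M :|: boundary M -> c \in M -> a != c -> ~~ e a c ->
    (forall k, k \in boundary M -> k = a \/ e a k) ->
    exists2 m, m \in M & clique [set x | e m x].
  move=> aMB cM aDc nac aB.
  pose D := [set x | (x != a) && ~~ e a x].
  pose C := [set x | connect (within D) c x].
  have cC : c \in C by rewrite inE connect0.
  have CD x : x \in C -> x \in D.
    rewrite inE => /connectP[p pth ->]; case: (lastP p) pth => [|p' z] /=.
      by rewrite inE eq_sym aDc nac.
    by rewrite rcons_path last_rcons => /andP[_ /and3P[]].
  have CM x : x \in C -> x \in M.
    rewrite inE => /connectP[p pth ->]; elim/last_ind: p pth => //= p z IHp.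
    rewrite rcons_path last_rcons => /andP[/IHp zM /and3P[_ zD ez]].
    apply/negPn/negP=> z_M.
    have zB : z \in boundary M.
      by rewrite inE z_M; apply/existsP; exists (last c p); rewrite zM e_sym.
    by move: zD; rewrite inE; case: (aB _ zB) => [->|->]; rewrite ?eqxx ?andbF.
  have connC : {in C &, forall x y, connect (within C) x y}.
    have fromc x : x \in C -> connect (within C) c x.
      rewrite inE => /connectP[p pth ->]; elim/last_ind: p pth => //= p z IHp.
      rewrite rcons_path last_rcons => /andP[pth wz].
      apply: (connect_trans (IHp pth)); apply: connect1.
      have lC : last c p \in C by rewrite inE; apply/connectP; exists p.
      rewrite /within lC; case/and3P: (wz) => _ _ ->; rewrite andbT.
      by move: lC; rewrite !inE => lC; exact: connect_trans lC (connect1 wz).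
    move=> x y xC yC; apply: (@connect_trans _ _ c); last exact: fromc.
    by rewrite (sym_connect_sym (@within_sym C)) fromc.
  have a_C : a \notin C by apply/negP=> /CD; rewrite inE eqxx.
  have aC : {in C, forall x, ~~ e a x} by move=> x /CD; rewrite inE => /andP[].
  have aBC x : x \in boundary C -> e a x.
    rewrite inE => /andP[x_C /existsP[y /andP[yC exy]]].
    apply/negPn/negP=> nax; have yD := CD _ yC.
    have xDa : x != a.
      by apply/eqP=> Exa; move: (aC y yC); rewrite -Exa exy.
    move/negP: x_C; apply; rewrite inE in yC; rewrite inE.
    apply: connect_trans yC (connect1 _).
    by rewrite /within yD e_sym exy inE xDa nax.
  have properCM : C \proper M.
    apply/properP; split; first by apply/subsetP.
    move: aMB; rewrite !inE => /orP[aM|/andP[_ /existsP[y /andP[yM eay]]]].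
      by exists a.
    by exists y => //; apply: contraL eay => /aC.
  have [|||m mC clm] := IHn C.
  - exact: leq_trans (proper_card properCM) leMn.
  - by apply/set0Pn; exists c.
  - exact: (neighbour_boundary_clique connC aBC aC a_C).
  - by exists m => //; apply: CM.
(* Pairs with [a] in the boundary come first, so that for [a] in [M] the boundary is already known
   to be joined to all of [M], as [step] requires. *)
have [|nob] := boolP [exists a in boundary M, exists c in M, ~~ e a c].
  case/existsP=> a /andP[aB /existsP[c /andP[cM nac]]].
  apply: (step a c) => //; first by rewrite inE aB orbT.
    by apply: contraTneq aB => ->; rewrite inE cM.
  move=> k kB; have [->|kDa] := eqVneq k a; first by left.
  by right; apply: clM => //; rewrite eq_sym.
have BM a c : a \in boundary M -> c \in M -> e a c.
  move=> aB cM; apply/negPn/negP=> nac; move/negP: nob; apply.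
  by apply/existsP; exists a; rewrite aB; apply/existsP; exists c; rewrite cM.
have [|noM] := boolP [exists a in M, exists c in M, (a != c) && ~~ e a c].
  case/existsP=> a /andP[aM /existsP[c /and3P[cM aDc nac]]].
  apply: (step a c) => //; first by rewrite inE aM.
  by move=> k kB; right; rewrite e_sym BM.
have MM a c : a \in M -> c \in M -> a != c -> e a c.
  move=> aM cM aDc; apply/negPn/negP=> nac; move/negP: noM; apply.
  apply/existsP; exists a; rewrite aM; apply/existsP; exists c.
  by rewrite cM aDc.
exists c0 => // x y; rewrite !inE => ex ey xDy.
have dich z : e c0 z -> z \in M \/ z \in boundary M.
  move=> ez; have [zM|zM] := boolP (z \in M); [by left | right].
  by rewrite inE zM; apply/existsP; exists c0; rewrite c0M e_sym.
case: (dich x ex) (dich y ey) => xX [] yX.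
- exact: MM.
- by rewrite e_sym BM.
- exact: BM.
- exact: clM.
Qed.

End Dirac.

(** * Mountains and hills as explicit configurations *)

Lemma edge_eqF (G : signed_graph) s t (x y : G) : edge s x y -> edge t x y = (t == s).
Proof.
move=> exy; have [->|ts] := eqVneq t s => //.
have -> : t = ~~ s by case: t s ts {exy} => -[].
exact/negbTE/edge_disj.
Qed.

Lemma edge_neq (G : signed_graph) s (x y : G) : edge s x y -> x != y.
Proof. by apply: contraTneq => ->; rewrite edge_irr. Qed.

(** Adjacencies of both signs are prescribed exactly, so the configuration is read in [G] itself.
    Only the first [n] values of [v] are constrained. *)
Definition mountain_in (G : signed_graph) s n (v : nat -> G) w : Prop :=
  [/\ 2 < n, {in gtn n &, injective v}, forall i, i < n -> v i != w,
      forall t i j, i < n -> j < n ->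
        edge t (v i) (v j) = (t == ~~ s) && ((j == i.+1) || (i == j.+1))
    & forall t i, i < n -> edge t w (v i) = (t == s) && (0 < i < n.-1)].

Definition hill_in (G : signed_graph) s n (v : nat -> G) w1 w2 : Prop :=
  [/\ 1 < n, {in gtn n &, injective v},
      forall i, i < n -> v i != w1 /\ v i != w2,
      forall t i j, i < n -> j < n ->
        edge t (v i) (v j) = (t == ~~ s) && ((j == i.+1) || (i == j.+1))
    & [/\ forall t, edge t w1 w2 = (t == s),
          forall t i, i < n -> edge t w1 (v i) = (t == s) && (i < n.-1)
        & forall t i, i < n -> edge t w2 (v i) = (t == s) && (0 < i)]].

Definition mountain_hill_free (G : signed_graph) : Prop :=
  forall s n (v : nat -> G),
    (forall w, ~ mountain_in s n v w) /\ (forall w1 w2, ~ hill_in s n v w1 w2).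

Lemma set2_eq (T : finType) (a b c d : T) :
  [set a; b] = [set c; d] -> a = c /\ b = d \/ a = d /\ b = c.
Proof.
move=> E.
have : a \in [set c; d] by rewrite -E !inE eqxx.
have : b \in [set c; d] by rewrite -E !inE eqxx orbT.
have : c \in [set a; b] by rewrite E !inE eqxx.
have : d \in [set a; b] by rewrite E !inE eqxx orbT.
rewrite !inE => /orP[]/eqP? /orP[]/eqP? /orP[]/eqP? /orP[]/eqP?; subst; auto.
Qed.

Lemma adjP (G : signed_graph) (x y : G) : reflect (exists s, edge s x y) (adj x y).
Proof. exact: existsP. Qed.

Lemma edge_induced (G : signed_graph) (A : {set G}) s (x y : induced A) :
  edge s x y = edge s (val x) (val y).
Proof. by []. Qed.

Lemma condC3_free (G : signed_graph) : condC3 G -> mountain_hill_free G.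
Proof.
move=> C3 s n v; split=> [w [n_gt2 injv vDw ev ew]|w1 w2 [n_gt1 injv vDw ev [eww ew1 ew2]]].
- pose A := w |: [set v (val i) | i : 'I_n].
  have wA : w \in A by rewrite !inE eqxx.
  have vA (i : 'I_n) : v i \in A.
    by rewrite !inE; apply/orP; right; apply/imsetP; exists i.
  have [+ _] := C3 A; apply.
  pose w' : induced A := Sub w wA; pose v' (i : 'I_n) : induced A := Sub (v i) (vA i).
  have cov (x : induced A) : x = w' \/ exists i, x = v' i.
    case: x => x xA; have := xA; rewrite !inE => /orP[/eqP xw|/imsetP[i _ xi]].
      by left; apply: val_inj.
    by right; exists i; apply: val_inj.
  exists s, n, v', w'; split=> //.
  - split=> //.
      move=> i j /(congr1 val) /= E; apply: val_inj; exact: injv (ltn_ord i) (ltn_ord j) E.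
    by move=> i; rewrite -val_eqE /= vDw.
  - by move=> i j E; rewrite edge_induced /= ev // E !eqxx.
  - by move=> i lti; rewrite edge_induced /= ew // lti eqxx.
  move=> x y /adjP[t]; case: (cov x) (cov y) => [->|[i ->]] [->|[j ->]].
  - by rewrite edge_irr.
  - rewrite edge_induced /= ew // => /andP[_ ltj].
    by right; exists j.
  - rewrite edge_sym edge_induced /= ew // => /andP[_ lti].
    by right; exists i; rewrite setUC.
  - rewrite edge_induced /= ev // => /andP[_ /orP[]/eqP E]; left.
      by exists i, j.
    by exists j, i; rewrite setUC.
pose A := w1 |: (w2 |: [set v (val i) | i : 'I_n]).
have w1A : w1 \in A by rewrite !inE eqxx.
have w2A : w2 \in A by rewrite !inE eqxx orbT.
have vA (i : 'I_n) : v i \in A.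
  by rewrite !inE; apply/orP; right; apply/orP; right; apply/imsetP; exists i.
have [_ +] := C3 A; apply.
pose w1' : induced A := Sub w1 w1A; pose w2' : induced A := Sub w2 w2A.
pose v' (i : 'I_n) : induced A := Sub (v i) (vA i).
have cov (x : induced A) : [\/ x = w1', x = w2' | exists i, x = v' i].
  case: x => x xA; have := xA; rewrite !inE => /or3P[/eqP xw|/eqP xw|/imsetP[i _ xi]].
  - by apply: Or31; apply: val_inj.
  - by apply: Or32; apply: val_inj.
  - by apply: Or33; exists i; apply: val_inj.
exists s, n, v', w1', w2'; split=> //.
- split=> //.
  + move=> i j /(congr1 val) /= E; apply: val_inj; exact: injv (ltn_ord i) (ltn_ord j) E.
  + by rewrite -val_eqE /= (edge_neq (s := s)) // eww eqxx.
  + by move=> i; rewrite -!val_eqE /=; apply: vDw.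
- by move=> i j E; rewrite edge_induced /= ev // E !eqxx.
- split.
  + by rewrite edge_induced /= eww.
  + by move=> i lti; rewrite edge_induced /= ew1 // lti eqxx.
  + by move=> i lti; rewrite edge_induced /= ew2 // lti eqxx.
move=> x y /adjP[t]; case: (cov x) (cov y) => [->|->|[i ->]] [->|->|[j ->]].
- by rewrite edge_irr.
- by move=> _; apply: Or42.
- rewrite edge_induced /= ew1 // => /andP[_ ltj].
  by apply: Or43; exists j.
- by move=> _; apply: Or42; rewrite setUC.
- by rewrite edge_irr.
- rewrite edge_induced /= ew2 // => /andP[_ ltj].
  by apply: Or44; exists j.
- rewrite edge_sym edge_induced /= ew1 // => /andP[_ lti].
  by apply: Or43; exists i; rewrite setUC.
- rewrite edge_sym edge_induced /= ew2 // => /andP[_ lti].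
  by apply: Or44; exists i; rewrite setUC.
- rewrite edge_induced /= ev // => /andP[_ /orP[]/eqP E]; apply: Or41.
    by exists i, j.
  by exists j, i; rewrite setUC.
Qed.

(** Disjointness of the signs turns the lists of required edges and of allowed pairs into exact
    adjacencies for both signs. *)
Lemma free_condC3 (G : signed_graph) : mountain_hill_free G -> condC3 G.
Proof.
move=> free A; split.
- case=> s [n [v [w [n_gt2 [injv vDw _] ev ew eadj]]]].
  case: n => // n in n_gt2 v injv vDw ev ew eadj *.
  pose v' i := val (v (inord i)).
  apply: (proj1 (free s n.+1 v') (val w)).
  have inj' i j : i < n.+1 -> j < n.+1 -> v' i = v' j -> i = j.
    by move=> lti ltj /val_inj/injv/(congr1 val); rewrite /= !inordK.
  split=> // [i lti|t i j lti ltj|t i lti]; first by rewrite val_eqE.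
    apply/idP/andP=> [eij|[/eqP-> /orP[]/eqP E]].
    + have [] := eadj (v (inord i)) (v (inord j)); first by apply/adjP; exists t.
      * case=> i' [j' [E /set2_eq E2]].
        have {E2} [[/injv Ei /injv Ej]|[/injv Ei /injv Ej]] := E2.
          have := ev _ _ E; rewrite -Ei -Ej => /edge_eqF <-; split=> //.
          by rewrite -(inordK lti) -(inordK ltj) Ei Ej E eqxx.
        have := ev _ _ E; rewrite -Ei -Ej edge_sym => /edge_eqF <-; split=> //.
        by rewrite -(inordK lti) -(inordK ltj) Ei Ej E eqxx orbT.
      * case=> i' [_ /set2_eq[[E _]|[_ E]]].
          by have := vDw (inord i); rewrite E eqxx.
        by have := vDw (inord j); rewrite E eqxx.
    + by apply: ev; rewrite !inordK.
    + by rewrite edge_sym; apply: ev; rewrite !inordK.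
  apply/idP/andP=> [ewi|[/eqP-> lei]]; last by apply: ew; rewrite inordK.
  have [] := eadj w (v (inord i)); first by apply/adjP; exists t.
    case=> i' [j' [_ /set2_eq[[E _]|[E _]]]].
      by have := vDw i'; rewrite E eqxx.
    by have := vDw j'; rewrite E eqxx.
  case=> i' [lei' /set2_eq[[_ /injv E]|[E _]]]; last first.
    by have := vDw i'; rewrite E eqxx.
  have := ew _ lei'; rewrite -E => /edge_eqF <-; split=> //.
  by rewrite -E inordK in lei'.
case=> s [n [v [w1 [w2 [n_gt1 [injv wDw vDw _] ev [eww ew1 ew2] eadj]]]]].
case: n => // n in n_gt1 v injv vDw ev ew1 ew2 eadj *.
pose v' i := val (v (inord i)).
apply: (proj2 (free s n.+1 v') (val w1) (val w2)).
have vDw1 i : v i <> w1 by case: (vDw i) => /eqP.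
have vDw2 i : v i <> w2 by case: (vDw i) => _ /eqP.
have inj' i j : i < n.+1 -> j < n.+1 -> v' i = v' j -> i = j.
  by move=> lti ltj /val_inj/injv/(congr1 val); rewrite /= !inordK.
split=> // [i lti|t i j lti ltj|]; first by rewrite !val_eqE.
  apply/idP/andP=> [eij|[/eqP-> /orP[]/eqP E]].
  + have [] := eadj (v (inord i)) (v (inord j)); first by apply/adjP; exists t.
    * case=> i' [j' [E /set2_eq E2]].
      have {E2} [[/injv Ei /injv Ej]|[/injv Ei /injv Ej]] := E2.
        have := ev _ _ E; rewrite -Ei -Ej => /edge_eqF <-; split=> //.
        by rewrite -(inordK lti) -(inordK ltj) Ei Ej E eqxx.
      have := ev _ _ E; rewrite -Ei -Ej edge_sym => /edge_eqF <-; split=> //.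
      by rewrite -(inordK lti) -(inordK ltj) Ei Ej E eqxx orbT.
    * by case/set2_eq=> [[/vDw1]|[/vDw2]].
    * by case=> i' [_ /set2_eq[[/vDw1]|[_ /vDw1]]].
    * by case=> i' [_ /set2_eq[[/vDw2]|[_ /vDw2]]].
  + by apply: ev; rewrite !inordK.
  + by rewrite edge_sym; apply: ev; rewrite !inordK.
split=> [t|t i lti|t i lti]; first exact: (edge_eqF _ eww).
  apply/idP/andP=> [ewi|[/eqP-> lei]]; last by apply: ew1; rewrite inordK.
  have [] := eadj w1 (v (inord i)); first by apply/adjP; exists t.
  - by case=> i' [j' [_ /set2_eq[[/esym/vDw1]|[/esym/vDw1]]]].
  - by case/set2_eq=> [[_ /vDw2]|[_ /vDw1]].
  - case=> i' [lei' /set2_eq[[_ /injv E]|[/esym/vDw1 //]]].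
    have := ew1 _ lei'; rewrite -E => /edge_eqF <-; split=> //.
    by rewrite -E inordK in lei'.
  - by case=> i' [_ /set2_eq[[/eqP]|[/esym/vDw1]]]; rewrite ?(negPf wDw).
apply/idP/andP=> [ewi|[/eqP-> lei]]; last by apply: ew2; rewrite inordK.
have [] := eadj w2 (v (inord i)); first by apply/adjP; exists t.
- by case=> i' [j' [_ /set2_eq[[/esym/vDw2]|[/esym/vDw2]]]].
- by case/set2_eq=> [[_ /vDw2]|[_ /vDw1]].
- by case=> i' [_ /set2_eq[[/esym/eqP]|[/esym/vDw2]]]; rewrite ?(negPf wDw).
- case=> i' [lei' /set2_eq[[_ /injv E]|[/esym/vDw2 //]]].
  have := ew2 _ lei'; rewrite -E => /edge_eqF <-; split=> //.
  by rewrite -E inordK in lei'.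
Qed.

(** * Removable vertices *)

Section Good.
Variable G : signed_graph.
Implicit Types (B : {set G}) (s : bool) (u v w x : G).

(** Distinctness of the three vertices follows from the edges, apart from [u != v] in the first
    clause. *)
Definition removable B w : Prop :=
  forall s u v, u \in B -> v \in B ->
    (u != v -> edge s u w -> edge s w v -> edge s u v) /\
    (edge s u v -> edge (~~ s) v w -> edge s u w).

Lemma SEO_removable : signed_eliminable G ->
  forall B, B != set0 -> exists2 w, w \in B & removable B w.
Proof.
case=> nu [/bij_inj inj_nu SEO] B /set0Pn[b bB].
case: (arg_maxnP (fun x => nu x : nat) bB) => w wB w_max; exists w => // s u v uB vB.
have lt_w x : x \in B -> x != w -> nu x < nu w.
  move=> xB xDw; rewrite ltn_neqAle [nu x <= nu w]w_max // andbT.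
  by apply: contra xDw => /eqP/val_inj/inj_nu->.
have SEO3 : u != v -> u != w -> v != w -> (edge s u w -> edge s w v -> edge s u v) /\
    (edge s u v -> edge (~~ s) v w -> edge s u w).
  move=> uDv uDw vDw; apply: SEO; rewrite ?lt_w //=.
  by rewrite !inE negb_or uDv uDw vDw.
split=> [uDv euw ewv|euv evw].
  by apply: (SEO3 _ _ _).1; rewrite ?(edge_neq euw) // eq_sym (edge_neq ewv).
apply: (SEO3 _ _ _).2 => //; rewrite ?(edge_neq euv) ?(edge_neq evw) //.
by apply: contraTneq evw => <-; rewrite edge_sym (edge_eqF _ euv); case: (s).
Qed.

(** Removable vertices are peeled off one after another and placed at the end of a list; the
    position in the list is the ordering. *)
Lemma removable_SEO :
  (forall B, B != set0 -> exists2 w, w \in B & removable B w) ->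
  signed_eliminable G.
Proof.
move=> rem.
have ordering B : exists l : seq G, [/\ uniq l, l =i B
    & forall w, w \in B -> removable [set x in B | index x l <= index w l] w].
  have [n] := ubnP #|B|; elim: n B => // n IHn B; rewrite ltnS => leBn.
  have [->|B0] := eqVneq B set0.
    by exists [::]; split=> // [x|w]; rewrite !inE.
  have [w wB rem_w] := rem B B0.
  have [|l [ul lB rem_l]] := IHn (B :\ w).
    by apply: leq_trans leBn; rewrite (cardsD1 w B) wB.
  have w_l : w \notin l by rewrite lB !inE eqxx.
  have iw : index w (rcons l w) = size l.
    by rewrite -cats1 index_cat (negPf w_l) /= eqxx addn0.
  exists (rcons l w); split=> [|x|x xB s u v].
  - by rewrite rcons_uniq w_l.
  - by rewrite mem_rcons inE lB !inE; case: eqP => // ->; rewrite wB.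
  rewrite !inE => /andP[uB leux] /andP[vB levx].
  have [E|xDw] := eqVneq x w; first by rewrite E; apply: rem_w.
  have xl : x \in l by rewrite lB !inE xDw.
  have ixl : index x (rcons l w) = index x l by rewrite -cats1 index_cat xl.
  have inl y : y \in B -> index y (rcons l w) <= index x (rcons l w) ->
      y \in [set x0 in B :\ w | index x0 l <= index x l].
    move=> yB; rewrite ixl => leyx.
    have yDw : y != w.
      by apply: contraTneq leyx => ->; rewrite iw -ltnNge index_mem.
    have yl : y \in l by rewrite lB !inE yDw.
    by move: leyx; rewrite -cats1 index_cat yl !inE yDw yB.
  apply: rem_l; rewrite ?inl // !inE xDw //.
have [l [ul lT rem_l]] := ordering setT.
have mem_l x : x \in l by rewrite lT inE.
have size_l : size l = #|G|.
  by rewrite -(card_uniqP ul); apply: eq_card => x; rewrite mem_l.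
have idx x : index x l < #|G| by rewrite -size_l index_mem.
exists (fun x => Ordinal (idx x)); split.
  apply: inj_card_bij; last by rewrite card_ord.
  by move=> x y [] E; rewrite -(nth_index x (mem_l x)) E nth_index.
move=> u v w uvw /ltnW /= leuw /ltnW levw s.
have [] := rem_l w (in_setT w) s u v; rewrite ?inE // => E1 E2; split=> //.
by apply: E1; move: uvw => /=; rewrite !inE negb_or -andbA => /and4P[].
Qed.

(** * Necessity of the three conditions *)

(** One of the four vertices is removable among them: [u] or [v] leads to the second alternative,
    [w] or [x] to the first. *)
Lemma SEO_condC2 : signed_eliminable G -> condC2 G.
Proof.
move=> /SEO_removable rem s u v w x.
rewrite /= !inE !negb_or -!andbA => /and5P[uDv uDw uDx vDw /and3P[vDx wDx _]].
move=> euv evw ewx; pose B := [set u; v; w; x].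
have [|y yB rem_y] := rem B; first by apply/set0Pn; exists u; rewrite !inE eqxx.
have [uB vB wB xB] : [/\ u \in B, v \in B, w \in B & x \in B].
  by rewrite !inE !eqxx !orbT.
have sK := negbK s.
move: yB; rewrite !inE -!orbA => /or4P[]/eqP Ey; subst y.
- right.
  have ewu : edge (~~ s) w u.
    by apply: (rem_y _ w v wB vB).2; rewrite ?sK edge_sym.
  have exu : edge s x u by apply: (rem_y _ x w xB wB).2; rewrite // edge_sym.
  have evx : edge s v x.
    by apply: (rem_y _ v x vB xB).1; rewrite // edge_sym.
  by rewrite edge_sym.
- right.
  have exv : edge s x v by apply: (rem_y _ x w xB wB).2; rewrite // edge_sym.
  by split; [apply: (rem_y _ u x uB xB).1; rewrite // edge_sym | rewrite edge_sym].
- left.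
  have euw : edge s u w by apply: (rem_y _ u v uB vB).2.
  by split=> //; apply: (rem_y _ u x uB xB).1.
- left.
  have evx : edge (~~ s) v x by apply: (rem_y _ v w vB wB).2; rewrite ?sK.
  have eux : edge s u x by apply: (rem_y _ u v uB vB).2.
  by split=> //; apply: (rem_y _ u w uB wB).1; rewrite // edge_sym.
Qed.

(** A removable vertex of the cycle would have its two cycle neighbours joined by a chord. *)
Lemma SEO_chordal s : signed_eliminable G -> chordal (@edge G s).
Proof.
move=> /SEO_removable rem n c n_ge4 [injc ec].
have n_gt0 : 0 < n by lia.
have [|y /imsetP[i _ ->] rem_i] := rem [set c i | i : 'I_n].
  by apply/set0Pn; exists (c (Ordinal n_gt0)); apply/imsetP; exists (Ordinal n_gt0).
have inB j : c j \in [set c i | i : 'I_n] by apply/imsetP; exists j.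
have [k Ek] : exists k, i = ordS k by exists (ord_pred i); rewrite ord_predK.
have iS : i == ordS k by rewrite Ek.
have kDi : k != ordS i.
  move: iS; rewrite !ordS_eqE; have := ltn_ord i; have := ltn_ord k.
  move: (i : nat) (k : nat); lia.
have := (rem_i s (c k) (c (ordS i)) (inB _) (inB _)).1.
rewrite !ec (inj_eq injc) iS kDi eqxx /= => /(_ isT isT isT).
have := eqxx (ordS i); move: iS; rewrite !ordS_eqE.
move: (ltn_ord i) (ltn_ord k) (ltn_ord (ordS i)).
move: (i : nat) (k : nat) (ordS i : nat); lia.
Qed.

(** Inner path vertices violate the first clause of [removable]; all other vertices violate the
    second, at the first or last edge of the path. *)
Lemma SEO_condC3 : signed_eliminable G -> condC3 G.
Proof.
move=> /SEO_removable rem; apply: free_condC3 => s n v.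
(* An inner vertex of the path cannot come last: its two path neighbours are
   not joined. *)
have inner B i : removable B (v i) -> 0 < i < n.-1 ->
    {in gtn n &, injective v} ->
    (forall k, k < n -> v k \in B) ->
    (forall t i j, i < n -> j < n ->
       edge t (v i) (v j) = (t == ~~ s) && ((j == i.+1) || (i == j.+1))) -> False.
  case: i => // i rem_i /= lti injv vB ev.
  have lt0 : i < n by lia.
  have lt1 : i.+1 < n by lia.
  have lt2 : i.+2 < n by lia.
  have := (rem_i (~~ s) _ _ (vB _ lt0) (vB _ lt2)).1.
  rewrite !ev // !eqxx /=; case: eqP => [/injv|_ /(_ isT isT isT)]; last by lia.
  by move=> /(_ lt0 lt2) /eqP; lia.
split=> [w [n_gt2 injv vDw ev ew]|w1 w2 [n_gt1 injv vDw ev [eww ew1 ew2]]].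
  pose B := w |: [set v (val i) | i : 'I_n].
  have wB : w \in B by rewrite !inE eqxx.
  have vB i : i < n -> v i \in B.
    move=> lti; rewrite !inE; apply/orP; right; apply/imsetP.
    by exists (Ordinal lti).
  have [|y yB rem_y] := rem B; first by apply/set0Pn; exists w.
  have lt0 : 0 < n by lia.
  have lt1 : 1 < n by lia.
  have lt2 : n.-1 < n by lia.
  have lt3 : n.-2 < n by lia.
  move: yB rem_y; rewrite !inE => /orP[/eqP->|/imsetP[[i lti] _ ->]] rem_y.
    have := (rem_y (~~ s) _ _ (vB _ lt0) (vB _ lt1)).2.
    rewrite ev // negbK ![edge _ _ w]edge_sym !ew // !eqxx /=.
    by move=> /(_ isT); lia.
  have [i0|i_gt0] := posnP i; last have [El|ne] := eqVneq i n.-1.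
  - move: rem_y; rewrite /= i0 => rem_0.
    have := (rem_0 s _ _ wB (vB _ lt1)).2.
    rewrite !ew // ev // !eqxx /=; lia.
  - move: rem_y; rewrite /= El => rem_0.
    have := (rem_0 s _ _ wB (vB _ lt3)).2.
    rewrite !ew // ev // !eqxx /=; lia.
  - by apply: (inner _ _ rem_y) => //=; lia.
pose B := w1 |: (w2 |: [set v (val i) | i : 'I_n]).
have w1B : w1 \in B by rewrite !inE eqxx.
have w2B : w2 \in B by rewrite !inE eqxx orbT.
have vB i : i < n -> v i \in B.
  move=> lti; rewrite !inE; apply/orP; right; apply/orP; right; apply/imsetP.
  by exists (Ordinal lti).
have [|y yB rem_y] := rem B; first by apply/set0Pn; exists w1.
have lt0 : 0 < n by lia.
have lt1 : 1 < n by lia.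
have lt2 : n.-1 < n by lia.
have lt3 : n.-2 < n by lia.
move: yB rem_y; rewrite !inE => /or3P[/eqP->|/eqP->|/imsetP[[i lti] _ ->]] rem_y.
(* On the path, [w1] misses only the last vertex and [w2] only the first; removability would force
   the missing edge. *)
- have := (rem_y (~~ s) _ _ (vB _ lt2) (vB _ lt3)).2.
  rewrite ev // negbK ![edge _ _ w1]edge_sym !ew1 // !eqxx /=; case: (s) => /=; lia.
- have := (rem_y (~~ s) _ _ (vB _ lt0) (vB _ lt1)).2.
  rewrite ev // negbK ![edge _ _ w2]edge_sym !ew2 // !eqxx /=; case: (s) => /=; lia.
have [i0|i_gt0] := posnP i; last have [El|ne] := eqVneq i n.-1.
- move: rem_y; rewrite /= i0 => rem_0.
  have := (rem_0 s _ _ w2B (vB _ lt1)).2.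
  rewrite !ew2 // ev // !eqxx /=; lia.
- move: rem_y; rewrite /= El => rem_0.
  have := (rem_0 s _ _ w1B (vB _ lt3)).2.
  rewrite !ew1 // ev // !eqxx /=; lia.
- by apply: (inner _ _ rem_y) => //=; lia.
Qed.

End Good.

(** * Sufficiency *)

Section Sufficiency.
Variable G : signed_graph.
Implicit Types (s : bool) (u v w x y z : G).

(** * Neighbourhoods of opposite sign along an edge *)

Definition nbr s v : {set G} := [set x | edge s v x].

Definition arc s : rel G :=
  fun v w => edge s v w && (nbr (~~ s) v \proper nbr (~~ s) w).

Definition tie s : rel G :=
  fun v w => edge s v w && (nbr (~~ s) v == nbr (~~ s) w).

Definition tie_class s w : {set G} := [set x | connect (tie s) w x].

Hypotheses (C2 : condC2 G) (free : mountain_hill_free G).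

(** This is (C2) for the opposite sign on the path [u], [v], [w], [x]: both alternatives contain the
    edge from [u] to [x] and differ in the other chord. *)
Lemma alternating_path s v w u x :
  edge s v w -> edge (~~ s) v u -> edge (~~ s) w x -> u != x ->
  edge (~~ s) u x /\ (edge (~~ s) w u || edge (~~ s) v x).
Proof.
move=> evw evu ewx uDx.
have neq (a b c : G) : edge s a b -> edge (~~ s) a c -> b != c.
  by move=> eab; apply: contraTneq => <-; rewrite (edge_eqF _ eab); case: (s).
have wDu := neq _ _ _ evw evu.
have vDx : v != x by apply: (neq w); rewrite // edge_sym.
have [||||[uw ->]|[-> ->]] := C2 (s := ~~ s) (u := u) (v := v) (w := w) (x := x).
- rewrite /= !inE !negb_or uDx vDx (edge_neq evw) (edge_neq ewx).
  by rewrite eq_sym (edge_neq evu) eq_sym wDu.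
- by rewrite edge_sym.
- by rewrite negbK.
- by [].
- by rewrite edge_sym uw.
- by rewrite orbT.
Qed.

Lemma cross_edge s v w u x :
  edge s v w -> edge (~~ s) v u -> edge (~~ s) w x -> u != x -> edge (~~ s) u x.
Proof. by move=> evw evu ewx /(alternating_path evw evu ewx)[]. Qed.

(** Witnesses against both inclusions would contradict the second half of [alternating_path]. *)
Lemma nbr_comparable s v w : edge s v w ->
  (nbr (~~ s) v \subset nbr (~~ s) w) || (nbr (~~ s) w \subset nbr (~~ s) v).
Proof.
move=> evw; apply/norP=> -[/subsetPn[u + nuw] /subsetPn[x + nxv]].
rewrite !inE in nuw nxv * => evu ewx.
have uDx : u != x by apply: contraNneq nuw => ->.
have [_] := alternating_path evw evu ewx uDx.
by rewrite (negPf nuw) (negPf nxv).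
Qed.

(** The vertex [w] is an [s]-neighbour of [v] but not of [z], which decides how these comparable
    sets are nested. *)
Lemma arc_of_missing_nbr s v w z :
  edge s v w -> edge (~~ s) z v -> ~~ edge s z w -> arc (~~ s) z v.
Proof.
move=> evw ezv nzw; rewrite /arc ezv negbK; have := nbr_comparable ezv.
rewrite negbK properE; case/orP=> sub; last first.
  by have := subsetP sub w; rewrite !inE evw (negPf nzw) => /(_ isT).
by rewrite sub; apply/subsetPn; exists w; rewrite !inE.
Qed.

Lemma tie_sym s : symmetric (tie s).
Proof. by move=> x y; rewrite /tie edge_sym eq_sym. Qed.

Lemma tie_class_nbr s w x : x \in tie_class s w -> nbr (~~ s) x = nbr (~~ s) w.
Proof.
rewrite inE => /connectP[p pth ->]; elim: p w pth => //= y p IHp w.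
by case/andP=> /andP[_ /eqP->] /IHp.
Qed.

(* Maximise [nbr false] to rule out arcs of sign + out of the class; since an
   arc of sign - followed by a tie or arc of sign + composes to an arc of sign
   -, maximising [nbr true] among such vertices rules out both signs. *)
Lemma terminal_vertex (x0 : G) :
  exists w, forall s v z, v \in tie_class s w -> ~~ arc s v z.
Proof.
pose terminal s w := [forall v in tie_class s w, forall z, ~~ arc s v z].
have escape s w : ~~ terminal s w ->
    exists2 v, v \in tie_class s w & exists z, arc s v z.
  rewrite negb_forall_in => /exists_inP[v vw]; rewrite negb_forall => /existsP[z].
  by rewrite negbK => az; exists v => //; exists z.
have grows s w v z : v \in tie_class s w -> arc s v z ->
    #|nbr (~~ s) w| < #|nbr (~~ s) z|.
  by move=> /tie_class_nbr <- /andP[_ /proper_card].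
have [w1 tw1] : exists w, terminal true w.
  have [w _ w_max] := @arg_maxnP _ x0 predT (fun w => #|nbr false w|) isT.
  exists w; apply/negPn/negP=> /escape[v vw [z avz]].
  by have := grows _ _ _ _ vw avz; rewrite ltnNge => /negP; apply; apply: w_max.
have [w tw w_max] := @arg_maxnP _ w1 (terminal true) (fun w => #|nbr true w|) tw1.
exists w; suff tf : terminal false w.
  move=> s v z vw; have : terminal s w by case: s vw.
  by move=> /forall_inP/(_ v vw)/forallP/(_ z).
apply/negPn/negP=> /escape[v vw [z0 avz0]].
(* The head [z] has most negative neighbours; a positive arc out of its tie class would lead to a
   better head [y']. *)
have [z avz z_max] :=
  @arg_maxnP _ z0 (arc false v) (fun z => #|nbr false z|) avz0.
have : terminal true z.
  apply/negPn/negP=> /escape[y yz [y' ayy']].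
  have lt_zy' := grows _ _ _ _ yz ayy'.
  have evy : edge false v y.
    case/andP: avz => evz _.
    have : v \in nbr false z by rewrite inE edge_sym.
    by rewrite -(tie_class_nbr yz) inE edge_sym.
  have evy' : edge false y' v.
    case/andP: ayy' => _ /proper_sub/subsetP/(_ v).
    by rewrite !inE edge_sym evy => /(_ isT).
  have avy' : arc false v y'.
    apply: (@arc_of_missing_nbr true y' y v).
    - by rewrite edge_sym; case/andP: ayy'.
    - by rewrite edge_sym.
    - by rewrite (edge_eqF _ evy).
  by move: lt_zy'; rewrite ltnNge => /negP; apply; apply: z_max.
move=> /w_max /=; rewrite leqNgt => /negP; apply; exact: grows vw avz.
Qed.

(* A path rising strictly at its first edge, constant inside and falling
   strictly at its last edge spans a mountain or a hill together with vertices
   lost at its two ends. *)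
Lemma no_plateau s n (v : nat -> G) (F : {set G}) :
  2 < n -> {in gtn n &, injective v} ->
  (forall i j, i < n -> j < n -> edge s (v i) (v j) = (j == i.+1) || (i == j.+1)) ->
  (forall i, 0 < i < n.-1 -> nbr (~~ s) (v i) = F) ->
  nbr (~~ s) (v 0) \proper F -> nbr (~~ s) (v n.-1) \proper F -> False.
Proof.
move=> n_gt2 injv ev vF.
have vD i j : i < n -> j < n -> i != j -> v i != v j.
  by move=> lti ltj; apply: contraNneq => /injv ->.
have edgeF s' (a b : G) : edge s' a b -> edge (~~ s') a b = false.
  by move=> eab; rewrite (edge_eqF _ eab); case: (s').
case/properP=> sub0 [z zF z0]; case/properP=> subn [y yF yn].
have subF i x : i < n -> edge (~~ s) x (v i) -> x \in F.
  move=> lti exi; have xi : x \in nbr (~~ s) (v i) by rewrite inE edge_sym.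
  case: (posnP i) => [i0|i_gt0]; first by apply: (subsetP sub0); rewrite -i0.
  have [El|ne] := eqVneq i n.-1; first by apply: (subsetP subn); rewrite -El.
  by rewrite -(vF i) //; lia.
have inF i x : 0 < i < n.-1 -> x \in F -> edge (~~ s) (v i) x.
  by move=> /vF <-; rewrite inE.
(* An inner vertex in [F] would be joined to itself; an end in [F] would be joined to its inner
   neighbour with both signs. *)
have vNF i : i < n -> v i \notin F.
  move=> lti; apply/negP=> viF.
  have [i_in|i_end] := boolP (0 < i < n.-1).
    by have := inF _ _ i_in viF; rewrite edge_irr.
  have [k [k_in eki]] : exists k, 0 < k < n.-1 /\ edge s (v k) (v i).
    by case: (posnP i) => ?; [exists 1 | exists i.-1]; rewrite ev; lia.
  by have := inF _ _ k_in viF; rewrite edgeF.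
have ev' t i j : i < n -> j < n ->
    edge t (v i) (v j) = (t == s) && ((j == i.+1) || (i == j.+1)).
  move=> lti ltj; have [->|ts] := eqVneq t s; first exact: ev.
  have -> : t = ~~ s by case: t s ts {ev vF sub0 z0 subn yn subF inF} => -[].
  by apply/negbTE/negP=> /(subF _ _ ltj); apply/negP/vNF.
(* At an end, such an edge would let [cross_edge], applied along the edge between [x] and the next
   inner vertex, join path vertices two apart. *)
have FNs x i : x \in F -> i < n -> ~~ edge s x (v i).
  move=> xF lti; apply/negP=> exi.
  have [El|ne] := eqVneq i n.-1; last have [i0|i_gt0] := posnP i.
  - have := @cross_edge (~~ s) (v n.-2) x (v (n - 3)) (v i).
    rewrite negbK exi inF; [|by lia|by []].
    have -> : v (n - 3) != v i by apply: vD; lia.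
    by rewrite !ev; lia.
  - have := @cross_edge (~~ s) (v 1) x (v 2) (v i).
    rewrite negbK exi inF; [|by lia|by []].
    have -> : v 2 != v i by apply: vD; lia.
    by rewrite !ev; lia.
  - have := inF i x; rewrite edge_sym edgeF // xF; lia.
have eF x t i : x \in F -> i < n ->
    edge t x (v i) = (t == ~~ s) && (x \in nbr (~~ s) (v i)).
  move=> xF lti; rewrite inE [edge (~~ s) _ _]edge_sym.
  have [->|ts] := eqVneq t (~~ s) => //.
  have -> : t = s by case: t s ts {ev ev' vF sub0 z0 subn yn subF inF FNs} => -[].
  exact/negbTE/FNs.
have vDF x i : x \in F -> i < n -> v i != x.
  by move=> xF lti; apply: contraTneq xF => <-; apply: vNF.
(* One vertex lost at both ends gives a mountain; its sign is [~~ s] because the path edges have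
   sign [s]. *)
have mountain x : x \in F -> x \notin nbr (~~ s) (v 0) ->
    x \notin nbr (~~ s) (v n.-1) -> False.
  move=> xF x0 xn; apply: (proj1 (free (~~ s) n v) x); split=> //.
  - by move=> i; apply: vDF.
  - by move=> t i j lti ltj; rewrite negbK ev'.
  move=> t i lti; rewrite eF //; congr (_ && _).
  have [i0|i_gt0] := posnP i; first by rewrite i0 (negPf x0).
  have [El|ne] := eqVneq i n.-1; first by rewrite El (negPf xn) ltnn.
  by rewrite vF ?xF //; lia.
have [zn|/mountain] := boolP (z \in nbr (~~ s) (v n.-1)); last by apply.
have [y0|y0] := boolP (y \in nbr (~~ s) (v 0)); last exact: (mountain y).
(* Now [y] is lost only at the last path vertex and [z] only at the first, so they serve as [w1] and
   [w2] of a hill. *)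
apply: (proj2 (free (~~ s) n v) y z); split=> //.
- by lia.
- by move=> i lti; rewrite !vDF.
- by move=> t i j lti ltj; rewrite negbK ev'.
have eyz : edge (~~ s) y z.
  apply: (@cross_edge s (v 0) (v 1)).
  - by rewrite ev; lia.
  - by rewrite inE in y0.
  - by apply: inF => //; lia.
  - by apply: contraNneq z0 => <-.
split=> [t|t i lti|t i lti]; first exact: edge_eqF.
  rewrite eF //; congr (_ && _).
  have [El|ne] := eqVneq i n.-1; first by rewrite El (negPf yn) ltnn.
  have [i0|i_gt0] := posnP i; first by rewrite i0 y0; lia.
  by rewrite vF ?yF; lia.
rewrite eF //; congr (_ && _).
have [i0|i_gt0] := posnP i; first by rewrite i0 (negPf z0).
have [El|ne] := eqVneq i n.-1; first by rewrite El zn.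
by rewrite vF ?zF; lia.
Qed.

(** * Removable vertices in terminal tie classes *)

(** A boundary vertex has a strictly smaller opposite neighbourhood than the class: equality would
    put it into the class, a larger set would give an arc out of it. A non-adjacent pair is then
    excluded by [no_plateau]. *)
Lemma tie_class_boundary_clique s w :
  (forall v z, v \in tie_class s w -> ~~ arc s v z) ->
  clique (@edge G s) (boundary (@edge G s) (tie_class s w)).
Proof.
move=> term.
have below x : x \in boundary (@edge G s) (tie_class s w) ->
    nbr (~~ s) x \proper nbr (~~ s) w.
  rewrite inE => /andP[xM /existsP[v /andP[vM exv]]].
  rewrite -(tie_class_nbr vM) properEneq.
  have xDv : nbr (~~ s) x != nbr (~~ s) v.
    apply: contra xM => E; rewrite inE in vM; rewrite inE.
    by apply: connect_trans vM (connect1 _); rewrite tie_sym /tie exv E.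
  rewrite xDv; case/orP: (nbr_comparable exv) => // sub.
  have := term v x vM; rewrite /arc edge_sym exv properEneq sub andbT.
  by rewrite eq_sym xDv.
move=> p q pB qB pDq; apply/negPn/negP=> npq.
have conn : {in tie_class s w &, forall x y,
    connect (within (@edge G s) (tie_class s w)) x y}.
  have fromw x : x \in tie_class s w ->
      connect (within (@edge G s) (tie_class s w)) w x.
    rewrite inE => /connectP[r pth ->]; elim/last_ind: r pth => //= r z IHr.
    rewrite rcons_path last_rcons => /andP[pth tz].
    apply: connect_trans (IHr pth) (connect1 _).
    have lM : connect (tie s) w (last w r) by apply/connectP; exists r.
    rewrite /within !inE lM (connect_trans lM (connect1 tz)).
    by case/andP: tz.
  move=> x y xM yM; apply: (@connect_trans _ _ w); last exact: fromw.
  rewrite (sym_connect_sym (within_sym (@edge_sym G s) _)); exact: fromw.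
have [n [v [n_gt2 v0 vl injv [vM ev]]]] :=
  induced_path_through (@edge_sym G s) (@edge_irr G s) conn pB qB pDq npq.
apply: (no_plateau (F := nbr (~~ s) w) n_gt2 injv ev).
- by move=> i /vM/tie_class_nbr.
- by rewrite v0; apply: below.
- by rewrite vl; apply: below.
Qed.

(** The arc would make [w] an [s]-neighbour of [z], while the tie makes it a neighbour of the other
    sign. *)
Lemma tied_no_arc s v w z : tie s v w -> ~~ arc (~~ s) v z.
Proof.
case/andP=> evw /eqP E; apply/negP=> /andP[evz].
have ewz : edge (~~ s) w z.
  have : z \in nbr (~~ s) v by rewrite inE.
  by rewrite E inE.
rewrite negbK => /proper_sub/subsetP/(_ w); rewrite !inE evw edge_sym => /(_ isT).
by rewrite (edge_eqF _ ewz); case: (s).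
Qed.

(** Each tie class of [w] contains a simplicial vertex for its sign. If [w] has a tie, that tie
    class settles the other sign too; otherwise [w] itself is simplicial for both signs. *)
Lemma removable_exists (x0 : G) : condC1 G -> exists w, removable [set: G] w.
Proof.
move=> [ch_true ch_false].
have ch s : chordal (@edge G s) by case: s.
have [w term] := terminal_vertex x0.
(* The cliques give the first clause of [removable]; absence of arcs out of [m] turns comparability
   into the inclusion behind the second. *)
suff [s [m [mM arcm cl1 cl2]]] : exists s m, [/\ m \in tie_class s w,
    forall z, ~~ arc (~~ s) m z, clique (@edge G s) (nbr s m)
    & clique (@edge G (~~ s)) (nbr (~~ s) m)].
  have arct t z : ~~ arc t m z.
    have [->|ts] := eqVneq t s; first exact: term.
    by have -> : t = ~~ s by case: t s ts {mM arcm cl1 cl2} => -[].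
  have clt t : clique (@edge G t) (nbr t m).
    have [->|ts] := eqVneq t s; first exact: cl1.
    by have -> : t = ~~ s by case: t s ts {mM arcm cl1 cl2} => -[].
  exists m => t u v _ _; split=> [uDv eum emv|euv evm].
    by apply: clt uDv; rewrite inE // edge_sym.
  have emv : edge (~~ t) m v by rewrite edge_sym.
  have sub : nbr t v \subset nbr t m.
    have := nbr_comparable emv; rewrite negbK => /orP[sub|//].
    apply: contraNT (arct (~~ t) v) => nsub.
    by rewrite /arc emv negbK properE sub nsub.
  by have := subsetP sub u; rewrite !inE edge_sym euv edge_sym => /(_ isT).
have simpl s : exists2 m, m \in tie_class s w & clique (@edge G s) (nbr s m).
  apply: (simplicial_exists (@edge_sym G s) (@edge_irr G s) (ch s)).
    by apply/set0Pn; exists w; rewrite inE connect0.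
  exact: tie_class_boundary_clique (term s).
have [|noties] := boolP [exists s, exists x, tie s w x].
  case/existsP=> s /existsP[x twx]; exists s.
  have [m mM cl] := simpl s; exists m.
  have [m' tm] : exists m', tie s m m'.
    move: mM; rewrite inE (sym_connect_sym (@tie_sym s)) => /connectP[[|m' p] /=].
      by move=> _ <-; exists x.
    by case/andP=> tm _ _; exists m'.
  split=> // [z|]; first exact: tied_no_arc tm.
  (* The neighbours of [m] of sign [~~ s] are also neighbours of [m'], so [cross_edge] joins any two
     of them. *)
  case/andP: tm => emm' /eqP E u v um.
  by rewrite E; move: um; rewrite !inE; apply: cross_edge emm'.
have single s x : x \in tie_class s w -> x = w.
  rewrite inE => /connectP[[|y p] //= /andP[twy _] _].
  by case/existsP: noties; exists s; apply/existsP; exists y.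
have cl s : clique (@edge G s) (nbr s w).
  by have [m /single-> ] := simpl s.
exists true, w; split=> //; rewrite ?inE ?connect0 // => z.
by apply: term; rewrite inE connect0.
Qed.

End Sufficiency.

(** * Passage to induced subgraphs and the equivalence *)

Lemma mountain_hill_free_induced (G : signed_graph) (A : {set G}) :
  mountain_hill_free G -> mountain_hill_free (induced A).
Proof.
move=> free s n v; have [nom noh] := free s n (val \o v); split=> [w|w1 w2].
  case=> n_gt2 injv vDw ev ew; apply: (nom (val w)); split=> //.
  by move=> i j lti ltj /val_inj; apply: injv.
case=> n_gt1 injv vDw ev [eww ew1 ew2]; apply: (noh (val w1) (val w2)); split=> //.
by move=> i j lti ltj /val_inj; apply: injv.
Qed.

Lemma condC1_induced (G : signed_graph) (A : {set G}) :
  condC1 G -> condC1 (induced A).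
Proof.
by case=> ch1 ch2; split=> n c n_ge4 [injc ec];
  [apply: (ch1 n (val \o c)) | apply: (ch2 n (val \o c))] => //;
  split=> // i j /val_inj/injc.
Qed.

Lemma condC2_induced (G : signed_graph) (A : {set G}) :
  condC2 G -> condC2 (induced A).
Proof.
move=> C2 s u v w x uniq4; apply: C2.
by rewrite -(map_inj_uniq val_inj) in uniq4.
Qed.

Theorem theorem5p1 (G : signed_graph) :
  signed_eliminable G <-> [/\ condC1 G, condC2 G & condC3 G].
Proof.
split=> [elim|[C1 C2 /condC3_free C3]].
  split; [split; exact: SEO_chordal | exact: SEO_condC2 | exact: SEO_condC3].
(* All three conditions pass to the subgraph induced on [B], whose removable vertices are removable
   in [B]. *)
apply: removable_SEO => B /set0Pn[b bB].
have [w rem_w] := removable_exists (@condC2_induced G B C2)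
  (@mountain_hill_free_induced G B C3) (Sub b bB) (@condC1_induced G B C1).
exists (val w); first exact: valP.
by move=> s u v uB vB; apply: (rem_w s (Sub u uB) (Sub v vB)); rewrite inE.
Qed.
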